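(* Let $S\subset\mathbb{R}^d$ be a compact set with polynomial reach $\mathbf R\in[0,\infty]$ such that $V(0)>0$, the right-hand derivative $V^+(0)$ of $V$ at $0$ exists and is finite, and $L_0(S)<\infty$. Let $X_1,X_2,\dots$ be i.i.d. random points in $S$ with distribution $P_X$, assume that $S$ is standard with respect to $P_X$, and let $\aleph_n=\{X_1,\dots,X_n\}$. Let $0=r_0<r_1<\dots<r_K$ be a grid, let $0<\eta<\frac1{2d}$ and $U_n=(\log n/n)^{\frac1{2d}-\eta}$. Then there exists an integer $\ell\ge d$ such that the output $\widehat{\mathbf R}=\widehat{\mathbf R}_n$ of the algorithm described in the context, run with $\aleph_n$, this grid, this $U_n$ and this $\ell$, satisfies, with probability one, $\widehat{\mathbf R}\le\mathbf R$ for all $n$ large enough.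
   Context: $S$ is non-empty and $K\ge2$. $\mu=\mu_d$ is Lebesgue measure on $\mathbb{R}^d$. For $A\subset\mathbb{R}^d$ and $r\ge0$, $B(A,r)=\{y:\inf_{x\in A}\|y-x\|\le r\}$; $B(x,\varepsilon)$ is the closed ball. The volume function is $V(r)=\mu(B(S,r))$ and the empirical volume function is $V_n(r)=\mu(B(\aleph_n,r))$, $r\ge0$. The polynomial reach of $S$ is $\mathbf R=\sup\{r\ge0: V\text{ is a polynomial of degree at most } d\text{ on }[0,r]\}\in[0,\infty]$. The Minkowski content is $L_0(S)=\lim_{\varepsilon\to0^+}\mu(B(\partial S,\varepsilon))/(2\varepsilon)$; ''$L_0(S)<\infty$'' means that this limit exists and is finite. $S$ is standard with respect to a Borel measure $\nu$ if there exist $\lambda>0$ and $\delta>0$ such that $\nu(B(x,\varepsilon)\cap S)\ge\delta\mu_d(B(x,\varepsilon))$ for all $x\in S$ and $0<\varepsilon\le\lambda$. For a compact interval $I\subset[0,\infty)$ of positive length and $\ell\in\mathbb N$, $P_{n,\ell}^I$ denotes the best approximation of $V_n$ in $L^2(I)$ by polynomials of degree at most $\ell$ (orthogonal projection), with $\|f\|_{L^2(I)}=(\int_I f^2)^{1/2}$. Algorithm. Put $I_i=[0,r_i]$ and $J_i=[r_i,r_K]$ for $i=1,\dots,K-1$. Inputs: the finite set $\aleph_n$, the grid, the threshold $U_n$, and an integer $\ell\ge d$. Step 0: if $\|V_n-P_{n,d}^{I_1}\|_{L^2(I_1)}>U_n$, the output is $\widehat{\mathbf R}=0$ and the algorithm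 stops. Step 1: otherwise, for $i=1,\dots,K-1$ let $$c_i=\frac{\|V_n-P_{n,d}^{I_i}\|_{L^2(I_i)}}{\|V_n-P_{n,\ell}^{J_i}\|_{L^2(J_i)}},$$ where $c_i>1$ is understood as ''the numerator is strictly larger than the denominator''. Output: if the algorithm did not stop at Step 0, let $i$ be the first index with $c_i>1$; the output is $\widehat{\mathbf R}=r_{i-1}$ if $i\ge2$, and $\widehat{\mathbf R}=r_1$ if $i=1$. If there is no such $i$, the output is $\widehat{\mathbf R}=r_{K-1}$. *)

(* Defs.v *)
From HB Require Import structures.
From mathcomp Require Import all_boot all_order all_algebra finmap.
From mathcomp Require Import all_classical all_reals all_analysis.

Set Implicit Arguments.
Unset Strict Implicit.
Unset Printing Implicit Defensive.

Import Order.TTheory GRing.Theory Num.Theory.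
Import numFieldNormedType.Exports.

Local Open Scope classical_set_scope.
Local Open Scope ring_scope.

(* R^d is 'rV[R]_d, with the product topology and its Borel sigma-algebra.
   The library's norm `|x| on 'rV[R]_d is the maximum norm, whence enorm. *)
Definition borel_rV (R : realType) (d : nat) :=
  g_sigma_algebraType (@open 'rV[R]_d).

Section EuclideanSpace.
Context {R : realType} {d : nat}.
Implicit Types (x a b : 'rV[R]_d) (A S : set 'rV[R]_d) (r : R).

Definition enorm x : R := Num.sqrt (\sum_(j < d) x 0 j ^+ 2).

(* The infimum is taken in \bar R, so that it is +oo for the empty set. *)
Definition thickening A r : set 'rV[R]_d :=
  [set y | (ereal_inf [set (enorm (y - x))%:E | x in A] <= r%:E)%E].

Definition cball x r : set 'rV[R]_d := [set y | enorm (y - x) <= r].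

Definition boundary A : set 'rV[R]_d := closure A `\` interior A.

Definition box a b : set 'rV[R]_d := [set x | forall j, a 0 j < x 0 j < b 0 j].

Definition box_vol a b : \bar R :=
  (\prod_(j < d) Num.max 0 (b 0 j - a 0 j))%:E.

(* d-dimensional Lebesgue measure, as an outer measure defined on all subsets;
   the measure proper is its restriction to the Caratheodory measurable sets.
   It is only applied to closed sets below. *)
Definition lebesgue_rV A : \bar R :=
  ereal_inf [set (\sum_(k <oo) box_vol (c k).1 (c k).2)%E |
    c in [set c : nat -> 'rV[R]_d * 'rV[R]_d |
            A `<=` \bigcup_k box (c k).1 (c k).2]].

End EuclideanSpace.

Section LebesgueOuterMeasure.
Context (R : realType) (d : nat).
Hypothesis d_gt0 : (0 < d)%N.
Local Open Scope ereal_scope.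
Implicit Types (A B : set 'rV[R]_d).

Lemma box_vol_ge0 (a b : 'rV[R]_d) : 0 <= box_vol a b.
Proof.
by rewrite lee_fin; apply: prodr_ge0 => j _; rewrite le_max lexx.
Qed.

Lemma lebesgue_rV_ge0 A : 0 <= lebesgue_rV A.
Proof.
apply: le_ereal_inf_tmp => _ [c _ <-].
by apply: nneseries_ge0 => k _ _; exact: box_vol_ge0.
Qed.

Lemma le_lebesgue_rV A B : A `<=` B -> lebesgue_rV A <= lebesgue_rV B.
Proof.
move=> AB; apply/ereal_inf_le_tmp => _ [c cB <-].
by exists c => //; exact: subset_trans AB cB.
Qed.

Lemma lebesgue_rV0 : lebesgue_rV (set0 : set 'rV[R]_d) = 0.
Proof.
apply/eqP; rewrite eq_le lebesgue_rV_ge0 andbT.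
apply: ereal_inf_lbound; exists (fun=> (0%R, 0%R)) => //.
apply: eseries0 => k _ _; rewrite /box_vol; congr EFin => /=.
by rewrite (bigD1 (Ordinal d_gt0)) //= mxE subrr maxxx mul0r.
Qed.

Lemma lebesgue_rV_sigma_subadditive :
  sigma_subadditive (@lebesgue_rV R d).
Proof.
move=> A; have [[i ioo]|] := pselect (exists i, lebesgue_rV (A i) = +oo).
  rewrite (eseries_pinfty _ _ ioo) ?leey// => n _.
  by rewrite -ltNye (lt_le_trans _ (lebesgue_rV_ge0 _)).
rewrite -forallNE => Aoo.
suff add2e (e : {posnum R}) :
    lebesgue_rV (\bigcup_n A n) <=
    \sum_(i <oo) lebesgue_rV (A i) + e%:num%:E.
  by apply/lee_addgt0Pr => _/posnumP[].
rewrite (le_trans _ (epsilon_trick _ _ _))//; last first.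
  by move=> n; exact: lebesgue_rV_ge0.
pose vol (c : 'rV[R]_d * 'rV[R]_d) := box_vol c.1 c.2.
have vol_ge0 c : 0 <= vol c by exact: box_vol_ge0.
pose P n (c : nat -> 'rV[R]_d * 'rV[R]_d) :=
  A n `<=` \bigcup_k box (c k).1 (c k).2 /\
  \sum_(k <oo) vol (c k) <= lebesgue_rV (A n) + (e%:num / (2 ^ n.+1)%:R)%:E.
have [G PG] : {G & forall n, P n (G n)}.
  apply: (@choice _ _ P) => n; rewrite /P /lebesgue_rV.
  set S := (X in ereal_inf X); move infS : (ereal_inf S) => iS.
  case: iS infS => [r Sr|Soo|Soo].
  - have en1 : (0 < e%:num / (2 ^ n.+1)%:R)%R by [].
    have /(lb_ereal_inf_adherent en1) : ereal_inf S \is a fin_num by rewrite Sr.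
    move=> [x [B AnB muBx] xS].
    by exists B; split => //; rewrite muBx -Sr; exact/ltW.
  - by have := Aoo n; rewrite /lebesgue_rV Soo.
  - suff : lbound S 0 by move/le_ereal_inf_tmp; rewrite Soo.
    by move=> /= _ [B AnB <-]; apply: nneseries_ge0 => k _ _; exact: vol_ge0.
have volG_ge0 x : 0 <= (vol \o uncurry G) x by exact: vol_ge0.
apply: (@le_trans _ _ (\esum_(i in setT) (vol \o uncurry G) i)).
  apply: ereal_inf_lbound => /=.
  have /card_esym/ppcard_eqP[f] := card_nat2.
  exists (uncurry G \o f).
    apply: (@subset_trans _ (\bigcup_n \bigcup_k box (G n k).1 (G n k).2)).
      by move=> t [i _] /((PG i).1) -[j _ ?]; exists i => //; exists j.
    move=> t [i _ [j _ Bijt]]; exists (f^-1%FUN (i, j)) => //=.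
    by rewrite invK ?inE.
  rewrite -(esum_pred_image (vol \o uncurry G) _ xpredT) ?[fun=> _]set_true//.
  by rewrite image_eq.
rewrite (_ : esum _ _ = \sum_(i <oo) \sum_(j <oo ) vol (G i j)); last first.
  pose J : nat -> set (nat * nat) := fun i => [set (i, j) | j in setT].
  rewrite (_ : setT = \bigcup_k J k); last first.
    by rewrite predeqE => -[a b]; split => // _; exists a => //; exists b.
  rewrite esum_bigcupT /=; last 2 first.
    - apply/trivIsetP => i j _ _ ij.
      rewrite predeqE => -[n m] /=; split => //= -[] [_] _ [<-{n} _].
      by move=> [m' _] [] /esym/eqP; rewrite (negbTE ij).
    - by move=> /= [n m]; exact: vol_ge0.
  rewrite -(image_id [set: nat]) -fun_true esum_pred_image//; last first.
    by move=> n _; exact: esum_ge0.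
  apply: eq_eseriesr => /= j _.
  rewrite -(esum_pred_image (vol \o uncurry G) (pair j) predT)//=; last first.
    by move=> ? ? _ _; exact: (@can_inj _ _ _ snd).
  by congr esum; rewrite predeqE => -[a b]; split; move=> [i _ <-]; exists i.
apply: lee_lim.
- apply: is_cvg_nneseries => n *.
  by apply: nneseries_ge0 => m *; exact: (volG_ge0 (n, m)).
- by apply: is_cvg_nneseries => n *; apply: adde_ge0 => //; exact: lebesgue_rV_ge0.
- by near=> n; apply: lee_sum => i _; exact: (PG i).2.
Unshelve. all: by end_near. Qed.

End LebesgueOuterMeasure.

(* d.+1 because in dimension 0 every box has volume 1 and every set, even set0,
   gets infinite outer measure. *)
HB.instance Definition _ (R : realType) (d : nat) :=
  isOuterMeasure.Build R 'rV[R]_d.+1 (@lebesgue_rV R d.+1)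
    (lebesgue_rV0 R (ltn0Sn d)) (@lebesgue_rV_ge0 R d.+1)
    (@le_lebesgue_rV R d.+1) (@lebesgue_rV_sigma_subadditive R d.+1).

Section VolumeFunction.
Context {R : realType} {d : nat}.
Implicit Types (A S : set 'rV[R]_d).

(* fine loses nothing on the bounded sets A considered here. *)
Definition volume A (r : R) : R := fine (lebesgue_rV (thickening A r)).

Definition polynomial_upto (m : nat) (f : R -> R) (r : R) : Prop :=
  exists2 p : {poly R}, (size p <= m.+1)%N &
    forall x, 0 <= x <= r -> f x = p.[x].

Definition polynomial_reach S : \bar R :=
  ereal_sup [set r%:E | r in
    [set r | 0 <= r /\ polynomial_upto d (volume S) r]].

Definition finite_right_derivative0 (f : R -> R) : Prop :=
  cvg ((fun h : R => (f h - f 0) / h) @ (0 : R)^'+).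

Definition finite_minkowski_content S : Prop :=
  cvg ((fun e : R => volume (boundary S) e / (2 * e)) @ (0 : R)^'+).

Definition standard S (nu : {measure set (borel_rV R d) -> \bar R}) : Prop :=
  exists lambda delta : R, [/\ 0 < lambda, 0 < delta &
    forall x e, S x -> 0 < e <= lambda ->
      (delta%:E * lebesgue_rV (cball x e) <= nu (cball x e `&` S))%E].

End VolumeFunction.

Section Sample.
Context {R : realType} {d : nat} {disp : measure_display}.
Context {Omega : measurableType disp} {P : probability Omega R}.
Implicit Types X : nat -> {RV P >-> borel_rV R d}.

Definition mutually_independent X : Prop :=
  forall (J : {fset nat}) (A : nat -> set (borel_rV R d)),
    (forall i, measurable (A i)) ->
    P (\bigcap_(i in [set` J]) X i @^-1` A i) =
    (\prod_(i <- J) P (X i @^-1` A i))%E.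

Definition identically_distributed X (PX : probability (borel_rV R d) R) :
    Prop :=
  forall i A, measurable A -> distribution P (X i) A = PX A.

(* The random points are numbered from 0: the sample of size n is
   {X 0, ..., X n.-1}. *)
Definition sample X (n : nat) (w : Omega) : set 'rV[R]_d :=
  [set X i w | i in `I_n].

End Sample.

Section Algorithm.
Context {R : realType}.
Implicit Types (f : R -> R) (a b : R) (l : nat) (p : {poly R}).

Definition L2norm a b f : R :=
  Num.sqrt (\int[lebesgue_measure]_(x in `[a, b]) (f x ^+ 2))%R.

Definition best_approximation a b l f p : Prop :=
  (size p <= l.+1)%N /\
  forall q : {poly R}, (size q <= l.+1)%N ->
    L2norm a b (fun x => f x - p.[x]) <= L2norm a b (fun x => f x - q.[x]).

(* For a < b and f in L^2([a, b]) such a polynomial exists and is unique, so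
   that the default value 0 of xget is not used. *)
Definition best_approx a b l f : {poly R} :=
  xget 0 [set p | best_approximation a b l f p].

Definition residual a b l f : R :=
  L2norm a b (fun x => f x - (best_approx a b l f).[x]).

(* c_i > 1 *)
Definition ratio_gt1 d l K (r : nat -> R) f (i : nat) : bool :=
  residual (r i) (r K) l f < residual 0 (r i) d f.

(* iota 1 K.-1 lists the indices 1, ..., K - 1. *)
Definition reach_estimator d l K (r : nat -> R) (U : R) f : R :=
  if U < residual 0 (r 1%N) d f then 0
  else match [seq i <- iota 1 K.-1 | ratio_gt1 d l K r f i] with
       | [::] => r K.-1
       | i :: _ => if (2 <= i)%N then r i.-1 else r 1%N
       end.

Definition threshold (d : nat) (eta : R) (n : nat) : R :=
  (ln n%:R / n%:R) `^ ((2 * d%:R)^-1 - eta).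

End Algorithm.

(* Main.v *)
(* Since S is compact and P_X charges every ball centred in S, almost surely
   the sample eventually meets every ball of a finite net of S, so that its
   Hausdorff distance to S tends to 0. Hence V(s - e) <= V_n(s) <= V(s) for
   large n, and V_n -> V at every continuity point of the nondecreasing
   function V, thus in L^2 of every compact interval; no rate is needed.
   Let j be the first index with R < r_j. The degree d residual rho of V on
   [0, r_j] is positive: were it 0, V would agree on [0, r_j) with a polynomial
   of degree at most d, whence R >= r_j. If j = 1, the residual of V_n on
   [0, r_1] eventually exceeds U_n -> 0 and the output is 0. If j >= 2, choose
   l so that polynomials of degree at most l approximate V in L^2([r_j, r_K])
   much better than rho; then eventually c_j > 1, so the first index i with
   c_i > 1 is at most j and the output is at most r_{j-1} <= R. If there is no
   such j, then R >= r_{K-1}, which bounds every output. *)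
Require Import Defs.
From HB Require Import structures.
From mathcomp Require Import all_boot all_order all_algebra finmap.
From mathcomp Require Import all_classical all_reals all_analysis.
From mathcomp Require Import measurable_realfun ring lra.

Set Implicit Arguments.
Unset Strict Implicit.
Unset Printing Implicit Defensive.

Import Order.TTheory GRing.Theory Num.Theory.
Import numFieldNormedType.Exports.

Local Open Scope classical_set_scope.
Local Open Scope ring_scope.

(** * Bounded measurable functions and best approximation *)

Section BoundedMeasurable.
Context {R : realType}.
Notation mu := (@lebesgue_measure R).
Implicit Types (f g : R -> R) (a b : R) (p q : {poly R}).

(** Boundedness makes products and squares integrable at once. The class contains the polynomials
    and the monotone functions, from which all integrands below are built. *)
Definition bounded_measurable a b f :=
  measurable_fun `[a, b] f /\ exists M, forall x, a <= x <= b -> `|f x| <= M.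

Lemma lebesgue_aeS (P Q : R -> Prop) : (forall x, P x -> Q x) ->
  {ae mu, forall x, P x} -> {ae mu, forall x, Q x}.
Proof. by move=> PQ aeP; apply: negligibleS aeP => x /= nQ Px; exact/nQ/PQ. Qed.

Lemma mu_itv_lty a b : (mu `[a, b] < +oo)%E.
Proof. by rewrite lebesgue_measure_itv/=; case: ifP => _; rewrite ?ltry. Qed.

Lemma bounded_measurable_integrable a b f :
  bounded_measurable a b f -> mu.-integrable `[a, b] (EFin \o f).
Proof.
move=> [mf [M fM]]; apply: measurable_bounded_integrable => //.
  exact: mu_itv_lty.
exists M; split; first exact: num_real.
by move=> N MN x /=; rewrite in_itv/= => /fM/le_trans; apply; exact: ltW.
Qed.

Lemma bounded_measurableD a b f g : bounded_measurable a b f ->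
  bounded_measurable a b g -> bounded_measurable a b (fun x => f x + g x).
Proof.
move=> [mf [M fM]] [mg [N gN]]; split; first exact: measurable_funD.
exists (M + N) => x xab; apply: le_trans (ler_normD _ _) _.
by apply: lerD; [exact: fM|exact: gN].
Qed.

Lemma bounded_measurableM a b f g : bounded_measurable a b f ->
  bounded_measurable a b g -> bounded_measurable a b (fun x => f x * g x).
Proof.
move=> [mf [M fM]] [mg [N gN]]; split; first exact: measurable_funM.
exists (M * N) => x xab; rewrite normrM.
by apply: ler_pM => //; [exact: fM|exact: gN].
Qed.

Lemma bounded_measurable_cst a b (c : R) : bounded_measurable a b (fun=> c).
Proof. by split; [exact: measurable_cst|exists `|c|]. Qed.

Lemma bounded_measurableB a b f g : bounded_measurable a b f ->
  bounded_measurable a b g -> bounded_measurable a b (fun x => f x - g x).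
Proof.
move=> bf bg; rewrite (_ : (fun x => _) = (fun x => f x + -1 * g x)); last first.
  by apply/funext => x; rewrite mulN1r.
by apply/bounded_measurableD/bounded_measurableM => //; exact: bounded_measurable_cst.
Qed.

Lemma bounded_measurableX2 a b f :
  bounded_measurable a b f -> bounded_measurable a b (fun x => f x ^+ 2).
Proof.
move=> bf; rewrite (_ : (fun x => _) = (fun x => f x * f x)).
  exact: bounded_measurableM.
by apply/funext => x; rewrite expr2.
Qed.

Lemma bounded_measurable_id a b : bounded_measurable a b id.
Proof.
split; first exact: measurable_id.
exists (`|a| + `|b|) => x /andP[ax xb]; rewrite ler_norml.
have := ler_norm (- a); have := ler_norm b; rewrite normrN.
have := normr_ge0 a; have := normr_ge0 b; lra.
Qed.

Lemma bounded_measurable_horner a b p : bounded_measurable a b (horner p).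
Proof.
elim/poly_ind: p => [|p c ih].
  rewrite (_ : horner 0 = fun=> 0); first exact: bounded_measurable_cst.
  by apply/funext => x; rewrite horner0.
rewrite (_ : horner _ = fun x => p.[x] * x + c); last first.
  by apply/funext => x; rewrite !hornerE.
apply: bounded_measurableD (bounded_measurable_cst _ _ _).
exact: bounded_measurableM ih (bounded_measurable_id _ _).
Qed.

Lemma bounded_measurable_nondecreasing a b f :
  {homo f : x y / x <= y} -> bounded_measurable a b f.
Proof.
move=> ndf; split; first exact: nondecreasing_measurable.
exists (`|f a| + `|f b|) => x /andP[/ndf ax /ndf xb]; rewrite ler_norml.
have := ler_norm (- f a); have := ler_norm (f b); rewrite normrN.
have := normr_ge0 (f a); have := normr_ge0 (f b); lra.
Qed.

Lemma RintegralD_bm a b f g :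
  bounded_measurable a b f -> bounded_measurable a b g ->
  \int[mu]_(x in `[a, b]) (f x + g x) =
  \int[mu]_(x in `[a, b]) f x + \int[mu]_(x in `[a, b]) g x.
Proof.
by move=> bf bg; apply: RintegralD => //; exact: bounded_measurable_integrable.
Qed.

Lemma RintegralB_bm a b f g :
  bounded_measurable a b f -> bounded_measurable a b g ->
  \int[mu]_(x in `[a, b]) (f x - g x) =
  \int[mu]_(x in `[a, b]) f x - \int[mu]_(x in `[a, b]) g x.
Proof.
by move=> bf bg; apply: RintegralB => //; exact: bounded_measurable_integrable.
Qed.

Lemma RintegralZl_bm a b f (c : R) : bounded_measurable a b f ->
  \int[mu]_(x in `[a, b]) (c * f x) = c * \int[mu]_(x in `[a, b]) f x.
Proof.
by move=> bf; apply: RintegralZl => //; exact: bounded_measurable_integrable.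
Qed.

Lemma le_Rintegral_bm a b f g :
  bounded_measurable a b f -> bounded_measurable a b g ->
  (forall x, a <= x <= b -> f x <= g x) ->
  \int[mu]_(x in `[a, b]) f x <= \int[mu]_(x in `[a, b]) g x.
Proof.
by move=> bf bg fg; apply: le_Rintegral => //;
  exact: bounded_measurable_integrable.
Qed.

Lemma bounded_measurable_sum a b n (F : 'I_n -> R -> R) :
  (forall i, bounded_measurable a b (F i)) ->
  bounded_measurable a b (fun x => \sum_(i < n) F i x).
Proof.
elim: n F => [|n ih] F bF.
  rewrite (_ : (fun x => _) = fun=> 0); first exact: bounded_measurable_cst.
  by apply/funext => x; rewrite big_ord0.
rewrite (_ : (fun x => _) =
    fun x => F ord0 x + \sum_(i < n) F (lift ord0 i) x); last first.
  by apply/funext => x; rewrite big_ord_recl.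
by apply: bounded_measurableD => //; exact: ih.
Qed.

Lemma Rintegral_sum_bm a b n (c : 'I_n -> R) (F : 'I_n -> R -> R) :
  (forall i, bounded_measurable a b (F i)) ->
  \int[mu]_(x in `[a, b]) (\sum_(i < n) c i * F i x) =
  \sum_(i < n) c i * \int[mu]_(x in `[a, b]) F i x.
Proof.
elim: n c F => [|n ih] c F bF.
  rewrite big_ord0; under eq_Rintegral do rewrite big_ord0.
  by rewrite Rintegral_cst ?mul0r.
rewrite big_ord_recl -ih//.
under eq_Rintegral do rewrite big_ord_recl.
rewrite RintegralD_bm ?RintegralZl_bm//.
  exact: bounded_measurableM (bounded_measurable_cst _ _ _) _.
apply: bounded_measurable_sum => i.
exact: bounded_measurableM (bounded_measurable_cst _ _ _) _.
Qed.

Lemma Rintegral_eq0_ae a b f : bounded_measurable a b f ->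
  (forall x, 0 <= f x) -> \int[mu]_(x in `[a, b]) f x = 0 ->
  {ae mu, forall x, a <= x <= b -> f x = 0}.
Proof.
move=> bf f0 intf.
have intE : (\int[mu]_(x in `[a, b]) `|(f x)%:E| = 0)%E.
  transitivity (\int[mu]_(x in `[a, b]) (f x)%:E)%E.
    by apply: eq_integral => x _ /=; rewrite ger0_norm.
  rewrite -[LHS]fineK; first by congr EFin.
  by apply: integrable_fin_num => //; exact: bounded_measurable_integrable.
have := (ae_eq_integral_abs mu (measurable_itv `[a, b])
  ((measurable_EFinP _ _).2 bf.1)).1 intE.
apply: filterS => x xf xab.
by have /= := xf _; rewrite in_itv/= => /(_ xab)[].
Qed.

(** Otherwise the open interval from [c] to [e], of positive length, would lie in a null set. *)
Lemma ae_itv_ex a b (P : R -> Prop) c e :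
  {ae mu, forall x, a <= x <= b -> P x} -> a <= c -> c < e -> e <= b ->
  exists x, c < x < e /\ P x.
Proof.
move=> [A [mA A0 AP]] ac ce eb; apply: contrapT => nP.
have : `]c, e[ `<=` A.
  move=> x /=; rewrite in_itv/= => xce; apply: AP => /= Px; apply: nP.
  by exists x; split=> //; apply: Px; move/andP: xce => [? ?]; apply/andP; split; lra.
move=> ceA; suff : (mu `]c, e[ <= 0)%E.
  by rewrite lebesgue_measure_itv/= lte_fin ce -EFinD lee_fin subr_le0 leNgt ce.
by rewrite -A0; apply: le_measure => //; rewrite inE.
Qed.

(** Infinitely many disjoint open intervals inside $[a,b]$ each contain a root, so there are
    [size p] distinct roots, too many for a nonzero [p]. *)
Lemma poly_ae0 a b p : a < b ->
  {ae mu, forall x, a <= x <= b -> p.[x] = 0} -> p = 0.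
Proof.
move=> ab aep.
(* The endpoints decrease from [b] towards [a]; a root is taken between [c n.+1] and [c n]. *)
pose c n : R := a + (b - a) / n.+1%:R.
have ba : 0 < b - a by rewrite subr_gt0.
have cS n : c n.+1 < c n.
  rewrite /c ltrD2l ltr_pM2l// ltf_pV2 ?posrE ?ltr0n// ltr_nat.
  by rewrite ltnS.
have clt n m : (n < m)%N -> c m < c n.
  elim: m => // m ih; rewrite ltnS leq_eqVlt => /predU1P[->//|/ih].
  exact: lt_trans.
have /choice[u uP] : forall n, exists x, c n.+1 < x < c n /\ p.[x] = 0.
  move=> n; apply: ae_itv_ex aep _ _ _ => //.
    by rewrite /c lerDl divr_ge0// ltW.
  by rewrite /c -lerBrDl ler_pdivrMr// ler_peMr ?ler1n// ltW.
have ult n m : (n < m)%N -> u m < u n.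
  move=> nm; have /andP[_ um] := (uP m).1; have /andP[un _] := (uP n).1.
  apply: lt_trans um (le_lt_trans _ un).
  by move: nm; rewrite leq_eqVlt => /predU1P[<-|/clt/ltW].
apply/eqP; apply/negP => /negP p0.
have := @max_poly_roots _ p (mkseq u (size p)) p0.
rewrite size_mkseq ltnn => H; suff : false by [].
apply: H; first by apply/allP => x /mapP[n _ ->]; rewrite /root (uP n).2.
apply: mkseq_uniq => n m; case: (ltngtP n m) => // /ult + e; by rewrite e ltxx.
Qed.

End BoundedMeasurable.

(** * Least-squares approximation by polynomials *)

Section BestApproximation.
Context {R : realType}.
Notation mu := (@lebesgue_measure R).
Implicit Types (f g : R -> R) (a b : R) (l : nat) (p q : {poly R}).

Lemma horner_sum_coef l p x : (size p <= l)%N ->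
  p.[x] = \sum_(i < l) p`_i * x ^+ i.
Proof.
move=> pl; rewrite -[p in LHS]coefK horner_poly.
rewrite (big_ord_widen l (fun i => p`_i * x ^+ i))// big_mkcond/=.
apply: eq_bigr => i _; case: ltnP => // /(nth_default 0) ->.
by rewrite mul0r.
Qed.

Lemma bounded_measurableXn a b n : bounded_measurable a b (fun x : R => x ^+ n).
Proof.
rewrite (_ : (fun x => _) = horner 'X^n); first exact: bounded_measurable_horner.
by apply/funext => x; rewrite hornerXn.
Qed.

(** The orthogonal projection is obtained by solving a linear system with the Gram matrix of the
    monomials. This matrix is invertible: a kernel vector yields a polynomial orthogonal to every
    monomial, hence to itself, hence zero by [poly_ae0]. *)
Lemma normal_equations a b l f : a < b -> bounded_measurable a b f ->
  exists2 p : {poly R}, (size p <= l.+1)%N & forall q, (size q <= l.+1)%N ->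
    \int[mu]_(x in `[a, b]) (q.[x] * (f x - p.[x])) = 0.
Proof.
move=> ab bf; have bX := bounded_measurableXn a b.
have bp p : bounded_measurable a b (horner p).
  exact: bounded_measurable_horner.
pose G : 'M[R]_l.+1 :=
  \matrix_(i, j) \int[mu]_(x in `[a, b]) (x ^+ j * x ^+ i).
pose P (c : 'rV[R]_l.+1) : {poly R} := \poly_(i < l.+1) c 0 (inord i).
have PE c x : (P c).[x] = \sum_(i < l.+1) c 0 i * x ^+ i.
  by rewrite horner_poly; apply: eq_bigr => i _; rewrite inord_val.
have cG c j :
    \int[mu]_(x in `[a, b]) (x ^+ (j : 'I_l.+1) * (P c).[x]) = (c *m G) 0 j.
  rewrite mxE; under [RHS]eq_bigr do rewrite mxE.
  rewrite -Rintegral_sum_bm; last by move=> i; exact: bounded_measurableM.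
  apply: eq_Rintegral => x _; rewrite PE mulr_sumr; apply: eq_bigr => i _.
  by rewrite mulrCA.
have span q g : (size q <= l.+1)%N -> bounded_measurable a b g ->
    \int[mu]_(x in `[a, b]) (q.[x] * g x) =
    \sum_(j < l.+1) q`_j * \int[mu]_(x in `[a, b]) (x ^+ j * g x).
  move=> ql bg; rewrite -Rintegral_sum_bm; last by move=> i; exact: bounded_measurableM.
  apply: eq_Rintegral => x _; rewrite (horner_sum_coef _ ql) mulr_suml.
  by apply: eq_bigr => i _; rewrite mulrA.
have Gunit : G \in unitmx.
  rewrite -row_free_unit; apply: inj_row_free => c cG0.
  have Pc0 : P c = 0.
    apply: (poly_ae0 ab).
    have : \int[mu]_(x in `[a, b]) ((P c).[x] ^+ 2) = 0.
      under eq_Rintegral do rewrite expr2.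
      rewrite span ?size_poly// big1// => j _.
      by rewrite cG cG0 mxE mulr0.
    move=> /(Rintegral_eq0_ae (bounded_measurableX2 (bp _)) (fun x => sqr_ge0 _)).
    by apply: lebesgue_aeS => x P0 /P0 /eqP; rewrite sqrf_eq0 => /eqP.
  apply/rowP => i; rewrite mxE.
  have := congr1 (fun p : {poly R} => p`_i) Pc0.
  by rewrite coef_poly ltn_ord inord_val coef0.
pose m : 'rV[R]_l.+1 := \row_j \int[mu]_(x in `[a, b]) (x ^+ j * f x).
exists (P (m *m invmx G)); first exact: size_poly.
move=> q ql; rewrite span//; last exact: bounded_measurableB.
apply: big1 => j _; under eq_Rintegral do rewrite mulrBr.
rewrite RintegralB_bm; try exact: bounded_measurableM.
by rewrite cG mulmxKV// mxE subrr mulr0.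
Qed.

Lemma best_approximation_exists a b l f : a < b -> bounded_measurable a b f ->
  exists p, best_approximation a b l f p.
Proof.
move=> ab bf; have [p pl pP] := normal_equations l ab bf.
have bp q : bounded_measurable a b (horner q).
  exact: bounded_measurable_horner.
exists p; split=> // q ql; apply: ler_wsqrtr.
have pq : (size (p - q)%R <= l.+1)%N.
  by apply: leq_trans (size_polyD _ _) _; rewrite geq_max pl size_polyN.
(* Pythagoras: the cross term vanishes by the normal equations applied to [p - q]. *)
have -> : \int[mu]_(x in `[a, b]) ((f x - q.[x]) ^+ 2) =
    \int[mu]_(x in `[a, b]) ((f x - p.[x]) ^+ 2 + (p - q).[x] ^+ 2 +
      2 * ((p - q).[x] * (f x - p.[x]))).
  by apply: eq_Rintegral => x _; rewrite hornerD hornerN;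
    move: (f x) p.[x] q.[x] => u v w; ring.
have bfp := bounded_measurableB bf (bp p).
rewrite !RintegralD_bm ?RintegralZl_bm ?pP ?mulr0 ?addr0 ?lerDl//.
- by apply: Rintegral_ge0 => x _; exact: sqr_ge0.
- exact: bounded_measurableM.
- exact: bounded_measurableX2.
- exact: bounded_measurableX2.
- by apply: bounded_measurableD; exact: bounded_measurableX2.
- apply: bounded_measurableM; first exact: bounded_measurable_cst.
  exact: bounded_measurableM.
Qed.

Lemma size_best_approx a b l f : (size (best_approx a b l f) <= l.+1)%N.
Proof.
(* The default value [0] of [xget] satisfies the bound as well. *)
by rewrite /best_approx; case: xgetP => [_ _ []|_]//; rewrite size_poly0.
Qed.

Lemma best_approxP a b l f : a < b -> bounded_measurable a b f ->
  best_approximation a b l f (best_approx a b l f).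
Proof.
by move=> ab bf; apply: xgetPex; exact: best_approximation_exists.
Qed.

Lemma residual_ge0 a b l f : 0 <= residual a b l f.
Proof. exact: sqrtr_ge0. Qed.

Lemma residual_sqr_le a b l f q : a < b -> bounded_measurable a b f ->
  (size q <= l.+1)%N ->
  residual a b l f ^+ 2 <= \int[mu]_(x in `[a, b]) ((f x - q.[x]) ^+ 2).
Proof.
move=> ab bf /(best_approxP l ab bf).2 h.
rewrite -[leRHS]sqr_sqrtr.
  by rewrite ler_sqr ?nnegrE ?sqrtr_ge0// residual_ge0.
by apply: Rintegral_ge0 => x _; exact: sqr_ge0.
Qed.

Lemma L2norm_sqr a b g :
  L2norm a b g ^+ 2 = \int[mu]_(x in `[a, b]) (g x ^+ 2).
Proof.
rewrite /L2norm sqr_sqrtr//.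
by apply: Rintegral_ge0 => x _; exact: sqr_ge0.
Qed.

(** This serves as a triangle inequality for squared norms. It holds pointwise, the difference of
    the two sides being the square of $f-2g+h$. *)
Lemma Rintegral_sqrB_le a b f g h : bounded_measurable a b f ->
  bounded_measurable a b g -> bounded_measurable a b h ->
  \int[mu]_(x in `[a, b]) ((f x - h x) ^+ 2) <=
    2 * \int[mu]_(x in `[a, b]) ((f x - g x) ^+ 2) +
    2 * \int[mu]_(x in `[a, b]) ((g x - h x) ^+ 2).
Proof.
move=> bf bg bh; have b2 := bounded_measurable_cst a b (2 : R).
have bfg := bounded_measurableX2 (bounded_measurableB bf bg).
have bgh := bounded_measurableX2 (bounded_measurableB bg bh).
have bfh := bounded_measurableX2 (bounded_measurableB bf bh).
rewrite -!RintegralZl_bm// -RintegralD_bm; try exact: bounded_measurableM.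
apply: le_Rintegral_bm => //.
  by apply: bounded_measurableD; exact: bounded_measurableM.
move=> x _; rewrite -subr_ge0.
have -> : 2 * (f x - g x) ^+ 2 + 2 * (g x - h x) ^+ 2 - (f x - h x) ^+ 2 =
  (f x - 2 * g x + h x) ^+ 2 by ring.
exact: sqr_ge0.
Qed.

(** The best approximation of [g] is used as a competitor in the approximation of [f]. *)
Lemma residual_perturb a b l f g : a < b -> bounded_measurable a b f ->
  bounded_measurable a b g ->
  residual a b l f ^+ 2 <= 2 * \int[mu]_(x in `[a, b]) ((f x - g x) ^+ 2) +
    2 * residual a b l g ^+ 2.
Proof.
move=> ab bf bg; set p := best_approx a b l g.
apply: (le_trans (residual_sqr_le ab bf (size_best_approx a b l g))).
rewrite [in leRHS]/residual L2norm_sqr; apply: Rintegral_sqrB_le => //.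
exact: bounded_measurable_horner.
Qed.

End BestApproximation.

(** * Polynomial approximation of monotone functions *)

(* [bernstein n g] is the Bernstein polynomial of the values g 0, ..., g n,
   that is [\sum_k 'C(n, k) g k 'X^k (1 - 'X)^(n - k)], in the form given by
   de Casteljau's recursion, for which the moments follow by induction. *)
Fixpoint bernstein {R : realType} (n : nat) (g : nat -> R) : {poly R} :=
  if n is n'.+1 then
    'X * bernstein n' (fun k => g k.+1) + (1 - 'X) * bernstein n' g
  else (g 0%N)%:P.

Section Bernstein.
Context {R : realType}.
Implicit Types (g h : nat -> R) (x c : R).

Lemma bernsteinS n g x : (bernstein n.+1 g).[x] =
  x * (bernstein n (fun k => g k.+1)).[x] + (1 - x) * (bernstein n g).[x].
Proof. by rewrite /= !hornerE. Qed.

Lemma le_bernstein n g h x : 0 <= x <= 1 ->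
  (forall k, (k <= n)%N -> g k <= h k) ->
  (bernstein n g).[x] <= (bernstein n h).[x].
Proof.
move=> /andP[x0 x1]; elim: n g h => [|n ih] g h gh.
  by rewrite !hornerC gh.
rewrite !bernsteinS; apply: lerD; apply: ler_wpM2l; rewrite ?subr_ge0//.
  by apply: ih => k kn; exact: gh.
by apply: ih => k kn; exact/gh/leqW.
Qed.

Lemma bernsteinDZ n g c h x : (bernstein n (fun k => g k + c * h k)).[x] =
  (bernstein n g).[x] + c * (bernstein n h).[x].
Proof.
elim: n g h => [|n ih] g h; first by rewrite !hornerC.
by rewrite !bernsteinS !ih; ring.
Qed.

Lemma bernstein_cst n c x : (bernstein n (fun=> c)).[x] = c.
Proof.
elim: n => [|n ih]; first by rewrite !hornerC.
by rewrite bernsteinS ih; ring.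
Qed.

(** This is the second moment about [t] of a binomial variable. The centre is left free for the
    induction: shifting the sequence in the recursion replaces [t] by [t - 1]. *)
Lemma bernstein_variance n (t x : R) :
  (bernstein n (fun k => (k%:R - t) ^+ 2)).[x] =
  (n%:R * x - t) ^+ 2 + n%:R * x * (1 - x).
Proof.
elim: n t => [|n ih] t; first by rewrite hornerC; ring.
rewrite bernsteinS ih.
rewrite (_ : (fun k => _) = fun k => (k%:R - (t - 1)) ^+ 2); last first.
  by apply/funext => k; rewrite -natr1; congr (_ ^+ 2); ring.
by rewrite ih -natr1; ring.
Qed.

(** By positivity, the bound on the values [g k] passes to the Bernstein polynomial, where the
    quadratic term becomes a binomial variance, at most [n.+1]. *)
Lemma bernstein_dist n g c x e C : 0 <= x <= 1 -> 0 <= C ->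
  (forall k, (k <= n.+1)%N ->
     `|c - g k| <= e + C * (k%:R - n.+1%:R * x) ^+ 2) ->
  `|c - (bernstein n.+1 g).[x]| <= e + C * n.+1%:R.
Proof.
move=> x01 C0 gc; have /andP[x0 x1] := x01.
have var : (bernstein n.+1 (fun k => (k%:R - n.+1%:R * x) ^+ 2)).[x] <= n.+1%:R.
  rewrite bernstein_variance subrr expr0n add0r -mulrA ler_piMr//.
  by rewrite mulr_ile1// ?subr_ge0// gerBl.
have up : (bernstein n.+1 g).[x] <= (c + e) + C * n.+1%:R.
  apply: (@le_trans _ _ (bernstein n.+1
    (fun k => (c + e) + C * (k%:R - n.+1%:R * x) ^+ 2)).[x]).
    apply: le_bernstein => // k /gc; rewrite ler_norml => /andP[+ _]; lra.
  by rewrite bernsteinDZ bernstein_cst lerD2l ler_wpM2l.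
have dn : (c - e) - C * n.+1%:R <= (bernstein n.+1 g).[x].
  apply: (@le_trans _ _ (bernstein n.+1
    (fun k => (c - e) + (- C) * (k%:R - n.+1%:R * x) ^+ 2)).[x]); last first.
    apply: le_bernstein => // k /gc; rewrite ler_norml => /andP[_]; lra.
  by rewrite bernsteinDZ bernstein_cst lerD2l mulNr lerN2 ler_wpM2l.
by rewrite ler_norml; apply/andP; split; lra.
Qed.

End Bernstein.

Section MonotoneApproximation.
Context {R : realType}.
Notation mu := (@lebesgue_measure R).
Implicit Types (f : R -> R) (a b : R).

(** The shift to [n.+1] makes the mesh well defined for every [n]. *)
Definition bernstein_itv a b f n : {poly R} :=
  bernstein n.+1 (fun k => f (a + (b - a) * (k%:R / n.+1%:R))) \Po
    ((b - a)^-1 *: ('X - a%:P)).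

Lemma grid_itv a b n k : a < b -> (k <= n.+1)%N ->
  a <= a + (b - a) * (k%:R / n.+1%:R) <= b.
Proof.
move=> ab kn; have ba : 0 < b - a by rewrite subr_gt0.
have k0 : 0 <= k%:R / n.+1%:R :> R by rewrite divr_ge0.
have k1 : k%:R / n.+1%:R <= 1 :> R by rewrite ler_pdivrMr// mul1r ler_nat.
apply/andP; split; first by rewrite lerDl mulr_ge0// ltW.
by rewrite -lerBrDl ler_piMr// ltW.
Qed.

Lemma itv01_scale a b x : a < b -> a <= x <= b -> 0 <= (b - a)^-1 * (x - a) <= 1.
Proof.
move=> ab /andP[ax xb]; have ba : 0 < b - a by rewrite subr_gt0.
rewrite mulrC; apply/andP; split.
  by rewrite divr_ge0 ?subr_ge0// ltW.
by rewrite ler_pdivrMr// mul1r lerD2r.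
Qed.

Lemma bernstein_itvE a b f n x : (bernstein_itv a b f n).[x] =
  (bernstein n.+1 (fun k => f (a + (b - a) * (k%:R / n.+1%:R)))).[
    (b - a)^-1 * (x - a)].
Proof. by rewrite /bernstein_itv horner_comp !hornerE. Qed.

Lemma bernstein_itv_bound a b f n M x : a < b -> a <= x <= b ->
  (forall x, a <= x <= b -> `|f x| <= M) -> `|(bernstein_itv a b f n).[x]| <= M.
Proof.
(* The goal is put in the form of [bernstein_dist] with [c = 0], [e = M] and [C = 0]. *)
move=> ab xab fM; rewrite bernstein_itvE -normrN -sub0r -[M]addr0.
rewrite -[X in M + X](mul0r n.+1%:R).
apply: bernstein_dist => //; first exact: itv01_scale.
by move=> k kn; rewrite mul0r addr0 sub0r normrN fM// grid_itv.
Qed.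

(** Nodes within [d] of [x] are handled by continuity at [x]. At any other node [y] the error is at
    most $2M\le 2M(y-x)^2/d^2$, and the variance makes the total contribution of these terms
    $O(1/n)$. *)
Lemma cvg_bernstein_itv a b f M x : a < b -> a <= x <= b ->
  (forall x, a <= x <= b -> `|f x| <= M) -> f y @[y --> x] --> f x ->
  (bernstein_itv a b f n).[x] @[n --> \oo] --> f x.
Proof.
move=> ab xab fM fx; apply/cvgrPdist_le => /= e e0.
have ba : 0 < b - a by rewrite subr_gt0.
have e20 : 0 < e / 2 by rewrite divr_gt0.
have /nbhs_ballP[d /= d0 dP] : \forall y \near x, `|f x - f y| < e / 2.
  exact: cvgr_dist_lt fx _ e20.
have M0 : 0 <= M by apply: le_trans (fM _ xab).
(* The factor $(b-a)^2$ accounts for the rescaling of $[a,b]$ to $[0,1]$. *)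
pose C := 2 * M / d ^+ 2 * (b - a) ^+ 2.
have C0 : 0 <= C by rewrite /C mulr_ge0 ?sqr_ge0// divr_ge0 ?sqr_ge0// mulr_ge0.
have dist n k : (k <= n.+1)%N ->
    `|f x - f (a + (b - a) * (k%:R / n.+1%:R))| <=
    e / 2 + C / n.+1%:R ^+ 2 * (k%:R - n.+1%:R * ((b - a)^-1 * (x - a))) ^+ 2.
  move=> kn; set y := a + _; have yab : a <= y <= b := grid_itv ab kn.
  have -> : C / n.+1%:R ^+ 2 * (k%:R - n.+1%:R * ((b - a)^-1 * (x - a))) ^+ 2 =
      2 * M / d ^+ 2 * (y - x) ^+ 2.
    rewrite /C /y; field.
    by rewrite !gt_eqF// ltr0n.
  have [xyd|xyd] := ltP `|x - y| d.
    apply: (@le_trans _ _ (e / 2)); first by apply/ltW/dP.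
    by rewrite lerDl mulr_ge0 ?sqr_ge0// divr_ge0 ?sqr_ge0// mulr_ge0.
  apply: (@le_trans _ _ (2 * M)).
    apply: le_trans (ler_normB _ _) _; have := fM _ xab; have := fM _ yab; lra.
  apply: (@le_trans _ _ (2 * M / d ^+ 2 * (y - x) ^+ 2)); last first.
    by rewrite lerDr ltW.
  rewrite -mulrA ler_peMr ?mulr_ge0// mulrC ler_pdivlMr ?exprn_gt0// mul1r.
  by rewrite -[leRHS]real_normK ?num_real// distrC ler_sqr ?nnegrE// ltW.
near=> n.
rewrite bernstein_itvE.
apply: (@le_trans _ _ (e / 2 + C / n.+1%:R ^+ 2 * n.+1%:R)).
  apply: bernstein_dist; [exact: itv01_scale| |exact: dist].
  by rewrite divr_ge0// sqr_ge0.
have -> : C / n.+1%:R ^+ 2 * n.+1%:R = C / n.+1%:R :> R.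
  by field; rewrite gt_eqF// ltr0n.
rewrite [leRHS]splitr lerD2l ler_pdivrMr// -ler_pdivrMl//.
near: n; exists (Num.bound ((e / 2)^-1 * C)) => // n /= Cn.
have eC0 : 0 <= (e / 2)^-1 * C by rewrite mulr_ge0// invr_ge0 ltW.
apply/ltW/(lt_le_trans (archi_boundP eC0)).
by rewrite ler_nat leqW.
Unshelve. all: by end_near. Qed.

Lemma bounded_convergence0 a b (h : nat -> R -> R) M :
  (forall n, measurable_fun `[a, b] (h n)) ->
  (forall n x, a <= x <= b -> `|h n x| <= M) ->
  {ae mu, forall x, a <= x <= b -> h n x @[n --> \oo] --> 0} ->
  \int[mu]_(x in `[a, b]) h n x @[n --> \oo] --> 0.
Proof.
move=> mh hM h0.
have [] := @dominated_convergence _ _ _ mu `[a, b] (measurable_itv _)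
  (fun n x => (h n x)%:E) (cst 0%:E) (cst M%:E).
- by move=> n; exact: (measurable_EFinP _ _).2 (mh n).
- exact: measurable_cst.
- apply: lebesgue_aeS h0 => x h0; rewrite /= in_itv/= => /h0 hx.
  by apply/fine_cvgP; split=> //; exact: nearW.
- exact: bounded_measurable_integrable (bounded_measurable_cst _ _ _).
- apply/aeW => x n /=; rewrite in_itv/= => xab; rewrite lee_fin; exact: hM.
move=> _ _ /=; rewrite integral0 => /fine_cvgP[_].
by [].
Qed.

(** Monotonicity provides both one-sided limits, so a point of discontinuity is a jump, and the
    jumps are countably many. *)
Lemma nondecreasing_ae_continuous a b f : {homo f : x y / x <= y} ->
  {ae mu, forall x, a <= x <= b -> f y @[y --> x] --> f x}.
Proof.
(* The margin of 1 makes [a] and [b] interior points. *)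
move=> ndf; pose D := [set x | x \in (`](a - 1), (b + 1)[) /\ discontinuity f x].
have cD : countable D by apply: discontinuity_countable => x y _ _; exact: ndf.
have nD : mu.-negligible D.
  apply/negligibleP; last exact: countable_lebesgue_measure0.
  exact: countable_measurable.
apply: negligibleS nD => x /= /not_implyP[/andP[ax xb] nc].
split; first by rewrite in_itv/=; apply/andP; split; lra.
have cl : cvg (f y @[y --> x^'-]).
  apply: nondecreasing_at_left_is_cvgr.
    by near=> z => u v _ _; exact: ndf.
  near=> z; exists (f x) => _ [y /= + <-]; rewrite in_itv/= => /andP[_ /ltW].
  exact: ndf.
have cr : cvg (f y @[y --> x^'+]).
  apply: nondecreasing_at_right_is_cvgr.
    by near=> z => u v _ _; exact: ndf.
  near=> z; exists (f x) => _ [y /= + <-]; rewrite in_itv/= => /andP[/ltW + _].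
  exact: ndf.
(* If the one-sided limits agree, then [f x], which lies between them, equals both. *)
split=> //; apply/eqP => lr; apply: nc; apply/left_right_continuousP.
have lx : lim (f y @[y --> x^'-]) <= f x.
  by apply: limr_le => //; near=> z; apply: ndf.
have rx : f x <= lim (f y @[y --> x^'+]).
  by apply: limr_ge => //; near=> z; apply: ndf.
split.
- by rewrite (_ : f x = lim (f y @[y --> x^'-]))//; apply/eqP; rewrite eq_le lx lr rx.
- by rewrite (_ : f x = lim (f y @[y --> x^'+]))//; apply/eqP; rewrite eq_le rx -lr lx.
Unshelve. all: by end_near. Qed.

Lemma cvg0_sqr (u : nat -> R) :
  u n @[n --> \oo] --> 0 -> u n ^+ 2 @[n --> \oo] --> 0.
Proof.
by move=> u0; under eq_fun do rewrite expr2; rewrite -(mulr0 0); exact: cvgM.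
Qed.

(** The Bernstein polynomials of [f] keep its bound [M] and converge to it at its continuity points,
    hence almost everywhere; bounded convergence concludes. *)
Lemma nondecreasing_L2_approx a b f e : a < b -> {homo f : x y / x <= y} ->
  0 < e -> exists q : {poly R}, \int[mu]_(x in `[a, b]) ((f x - q.[x]) ^+ 2) < e.
Proof.
move=> ab ndf e0.
have bf : bounded_measurable a b f := bounded_measurable_nondecreasing a b ndf.
have [_ [M fM]] := bf.
have : \int[mu]_(x in `[a, b]) ((f x - (bernstein_itv a b f n).[x]) ^+ 2)
    @[n --> \oo] --> 0.
  apply: (@bounded_convergence0 _ _ _ ((M + M) ^+ 2)).
  - move=> n; apply: (bounded_measurableX2 (bounded_measurableB bf _)).1.
    exact: bounded_measurable_horner.
  - move=> n x xab; rewrite normrX ler_sqr ?nnegrE//; last first.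
      by rewrite addr_ge0// (le_trans _ (fM _ xab)).
    apply: le_trans (ler_normB _ _) _; apply: lerD; first exact: fM.
    exact: bernstein_itv_bound.
  - apply: lebesgue_aeS (nondecreasing_ae_continuous a b ndf) => x cx xab.
    have := cvg_bernstein_itv ab xab fM (cx xab) => /(cvgB (cvg_cst (f x))).
    by rewrite subrr; exact: cvg0_sqr.
move=> /cvgr0Pnorm_lt /(_ _ e0)/filter_ex[n /= H].
exists (bernstein_itv a b f n).
by apply: le_lt_trans _ H; exact: ler_norm.
Qed.

(* [Vn] is squeezed between the translates of [V] to the left and [V] itself,
   so it converges to [V] wherever [V] is continuous. *)
Lemma cvg_L2_squeeze a b (V : R -> R) (Vn : nat -> R -> R) :
  {homo V : x y / x <= y} -> (forall x, 0 <= V x) ->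
  (forall n, {homo Vn n : x y / x <= y}) ->
  (forall n x, 0 <= Vn n x <= V x) ->
  (forall e, 0 < e -> \forall n \near \oo, forall x, V (x - e) <= Vn n x) ->
  \int[mu]_(x in `[a, b]) ((V x - Vn n x) ^+ 2) @[n --> \oo] --> 0.
Proof.
move=> ndV V0 ndVn VnV VVn.
have [_ [M VM]] := bounded_measurable_nondecreasing a b ndV.
apply: (@bounded_convergence0 _ _ _ (M ^+ 2)).
- move=> n; apply: (bounded_measurableX2 (bounded_measurableB _ _)).1;
    exact: bounded_measurable_nondecreasing.
- move=> n x xab; have /andP[Vn0 VnVx] := VnV n x; have VxM := VM _ xab.
  rewrite normrX ler_sqr ?nnegrE//; last exact: le_trans VxM.
  rewrite ger0_norm ?subr_ge0//; apply: le_trans VxM.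
  by rewrite ger0_norm// gerBl.
- apply: lebesgue_aeS (nondecreasing_ae_continuous a b ndV) => x cx xab.
  apply: cvg0_sqr.
  apply/cvgr0Pnorm_lt => e e0.
  have /nbhs_ballP[d /= d0 dP] : \forall y \near x, `|V x - V y| < e.
    exact: cvgr_dist_lt (cx xab) _ e0.
  have d20 : 0 < d / 2 by rewrite divr_gt0.
  apply: filterS (VVn _ d20) => n VVnn; have /andP[_ VnVx] := VnV n x.
  have : `|V x - V (x - d / 2)| < e.
    apply: dP; rewrite /ball/= opprB addrC subrK gtr0_norm//.
    by rewrite ltr_pdivrMr// ltr_pMr// ltr1n.
  apply: le_lt_trans; rewrite ger0_norm ?subr_ge0//.
  apply: le_trans (ler_norm _); have := VVnn x; lra.
Qed.

End MonotoneApproximation.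

(** * The estimator as a function of the volume functions *)

Section ReachEstimator.
Context {R : realType}.
Notation mu := (@lebesgue_measure R).
Implicit Types (f : R -> R) (b : R).

(** A zero residual gives equality with the best approximation almost everywhere. Monotonicity of
    [f] and continuity of the polynomial extend it to every interior point, and right continuity
    extends it to [0]. At [b] the function may jump, hence the half-open interval. *)
Lemma residual0_polynomial b d f : 0 < b -> {homo f : x y / x <= y} ->
  f x @[x --> 0^'+] --> f 0 -> residual 0 b d f = 0 ->
  exists2 p : {poly R}, (size p <= d.+1)%N & forall x, 0 <= x < b -> f x = p.[x].
Proof.
move=> b0 ndf f0 res0; exists (best_approx 0 b d f); first exact: size_best_approx.
set p := best_approx 0 b d f.
have aep : {ae mu, forall x, 0 <= x <= b -> f x = p.[x]}.
  have bfp := bounded_measurableB (bounded_measurable_nondecreasing 0 b ndf)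
    (bounded_measurable_horner 0 b p).
  have := Rintegral_eq0_ae (bounded_measurableX2 bfp) (fun x => sqr_ge0 _).
  rewrite -L2norm_sqr -/(residual 0 b d f) res0 expr0n => /(_ erefl).
  by apply: lebesgue_aeS => x h /h /eqP; rewrite sqrf_eq0 subr_eq0 => /eqP.
have fpos x : 0 < x < b -> f x = p.[x].
  move=> /andP[x0 xb].
  (* The proof is by contradiction: close to [x], [p] varies by less than the supposed gap between
     [p.[x]] and [f x]. The second alternative covers the case without a gap. *)
  have cp : \forall e \near 0^'+, forall y, `|y - x| < e ->
      `|p.[x] - p.[y]| < `|p.[x] - f x| \/ f x = p.[x].
    have [->|fx] := eqVneq (f x) p.[x]; first by near=> e; right.
    have e0 : 0 < `|p.[x] - f x| by rewrite normr_gt0 subr_eq0 eq_sym.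
    have /nbhs_ballP[d0 /= d00 dP] : \forall y \near x,
        `|p.[x] - p.[y]| < `|p.[x] - f x|.
      exact: cvgr_dist_lt (@continuous_horner _ p x) _ e0.
    near=> e => y ye; left; apply: dP; rewrite /ball/= distrC; apply: lt_trans ye _.
    by near: e; exact: nbhs_right_lt.
  have /filter_ex[e [e0 [eb [ex eP]]]] :
      \forall e \near (0 : R)^'+, 0 < e /\ (e < b - x /\ (e < x /\
      forall y, `|y - x| < e -> `|p.[x] - p.[y]| < `|p.[x] - f x| \/ f x = p.[x])).
    near=> e; split; first by near: e; exact: nbhs_right_gt.
    split; first by near: e; apply: nbhs_right_lt; rewrite subr_gt0.
    by split; near: e => //; exact: nbhs_right_lt.
  (* Points of equality [z < x < y] give $p(z)\le f(x)\le p(y)$. Depending on the sign of the gap,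
     [z] or [y] contradicts the small variation of [p]. *)
  have [y [/andP[xy ye] fy]] : exists y, x < y < x + e /\ f y = p.[y].
    by apply: ae_itv_ex aep _ _ _; lra.
  have [z [/andP[zx ze] fz]] : exists z, x - e < z < x /\ f z = p.[z].
    by apply: ae_itv_ex aep _ _ _; lra.
  have yxe : `|y - x| < e by rewrite ltr_norml; apply/andP; split; lra.
  have zxe : `|z - x| < e by rewrite ltr_norml; apply/andP; split; lra.
  have [py|//] := eP _ yxe; have [pz|//] := eP _ zxe.
  move: (ndf _ _ (ltW xy)) (ndf _ _ (ltW ze)) py pz; rewrite fy fz.
  by have [pf|pf] := ger0P (p.[x] - f x);
    rewrite !ltr_norml => ? ? /andP[? ?] /andP[? ?]; lra.
move=> x /andP[]; rewrite le_eqVlt => /predU1P[<- _|x0 xb]; last first.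
  by apply: fpos; rewrite x0.
apply: (cvg_unique _ f0); first exact: norm_hausdorff.
have : p.[x0] @[x0 --> 0^'+] --> p.[0].
  by apply: cvg_at_right_filter; exact: continuous_horner.
apply: cvg_trans; apply: near_eq_cvg; near=> y; rewrite fpos//.
by apply/andP; split; near: y; [exact: nbhs_right_gt|exact: nbhs_right_lt].
Unshelve. all: by end_near. Qed.

(* [polynomial_reach S] is [reach_at_most d (volume S)] by conversion. *)
Definition reach_at_most d f : \bar R :=
  ereal_sup [set r%:E | r in [set r | 0 <= r /\ polynomial_upto d f r]].

Lemma reach_ge d f x : 0 <= x -> polynomial_upto d f x ->
  (x%:E <= reach_at_most d f)%E.
Proof. by move=> x0 px; apply: ereal_sup_ubound; exists x. Qed.

Lemma reach_ge0 d f : (0 <= reach_at_most d f)%E.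
Proof.
apply: reach_ge => //; exists (f 0)%:P.
  by rewrite (leq_trans (size_polyC_leq1 _)).
by move=> x /le_anti <-; rewrite hornerC.
Qed.

(** With a zero residual, [f] would be polynomial on $[0,b)$. Since [b] is excluded, the
    contradiction comes from the midpoint between the reach and [b]. *)
Lemma residual_gt0_reach b d f : {homo f : x y / x <= y} ->
  f x @[x --> 0^'+] --> f 0 -> (reach_at_most d f < b%:E)%E ->
  0 < residual 0 b d f.
Proof.
move=> ndf f0 fb; have b0 : 0 < b by rewrite -lte_fin (le_lt_trans (reach_ge0 d f)).
rewrite lt_neqAle residual_ge0 andbT; apply/eqP => /esym.
move=> /(residual0_polynomial b0 ndf f0)[p pd fp].
have := reach_ge0 d f; move: fb; case: (reach_at_most d f) (@reach_ge d f) => // c cP.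
rewrite lte_fin lee_fin => cb c0.
have : (((c + b) / 2)%:E <= c%:E)%E.
  apply: cP; first by lra.
  by exists p => // x /andP[x0 xc]; apply: fp; rewrite x0/=; lra.
by rewrite lee_fin; lra.
Qed.

Section EstimatorBounds.
Context (d l K : nat) (r : nat -> R) (U : R) (f : R -> R).
Hypotheses (K2 : (2 <= K)%N) (r0 : r 0%N = 0).
Hypothesis r_incr : forall i, (i < K)%N -> r i < r i.+1.

Lemma grid_le i j : (i <= j)%N -> (j <= K)%N -> r i <= r j.
Proof.
elim: j => [|j ih]; first by rewrite leqn0 => /eqP ->.
rewrite leq_eqVlt => /predU1P[->//|ij jK].
by apply: le_trans (ih ij (ltnW jK)) (ltW (r_incr jK)).
Qed.

Lemma grid_lt i j : (i < j)%N -> (j <= K)%N -> r i < r j.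
Proof.
move=> ij jK; apply: lt_le_trans (grid_le ij jK).
exact/r_incr/(leq_trans ij).
Qed.

Lemma reach_estimator_stop0 :
  U < residual 0 (r 1%N) d f -> reach_estimator d l K r U f = 0.
Proof. by rewrite /reach_estimator => ->. Qed.

Lemma reach_estimator_le_last : reach_estimator d l K r U f <= r K.-1.
Proof.
have K1 : (1 <= K.-1)%N by case: K K2 => [|[]].
have KK : (K.-1 <= K)%N := leq_pred _.
rewrite /reach_estimator; case: ifP => _; first by rewrite -r0 grid_le.
case E : [seq i <- _ | _] => [//|i s].
have : i \in i :: s by rewrite mem_head.
rewrite -E mem_filter mem_iota add1n => /and3P[_ i1 iK].
case: ifP => _; apply: grid_le => //.
by rewrite (leq_trans (leq_pred _))// -(prednK (ltnW K2)).
Qed.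

(** The filtered list is increasing, so its head [i] is at most [j]. If [i = 1] the output [r 1] is
    still at most [r j.-1], because [j] is at least 2. *)
Lemma reach_estimator_le_ratio j : (2 <= j < K)%N -> ratio_gt1 d l K r f j ->
  reach_estimator d l K r U f <= r j.-1.
Proof.
move=> /andP[j2 jK] rj.
have j1 : (1 <= j.-1)%N by case: j j2 {jK rj} => [|[]].
have jK' : (j.-1 <= K)%N by exact: leq_trans (leq_pred _) (ltnW jK).
rewrite /reach_estimator; case: ifP => _; first by rewrite -r0 grid_le.
have : j \in [seq i <- iota 1 K.-1 | ratio_gt1 d l K r f i].
  by rewrite mem_filter rj mem_iota add1n (prednK (ltnW K2)) jK (ltnW j2).
have := sorted_filter ltn_trans (ratio_gt1 d l K r f) (iota_ltn_sorted 1 K.-1).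
case: [seq i <- _ | _] => [//|i s] /= /(order_path_min ltn_trans)/allP is_.
rewrite inE => jis; have ij : (i <= j)%N.
  by case/predU1P: jis => [->//|/is_/ltnW].
case: ifP => _; apply: grid_le => //.
by rewrite -!subn1 leq_sub2r.
Qed.

End EstimatorBounds.

(** This is the deterministic core. The degree [l] is chosen from [f] and the grid, before [U] and
    [fn], so that one [l] serves all sample points. *)
Lemma reach_estimator_le_reach d K (r : nat -> R) f :
  (2 <= K)%N -> r 0%N = 0 -> (forall i, (i < K)%N -> r i < r i.+1) ->
  {homo f : x y / x <= y} -> (forall x, 0 <= f x) ->
  f x @[x --> 0^'+] --> f 0 ->
  exists2 l : nat, (d <= l)%N & forall (U : nat -> R) (fn : nat -> R -> R),
    U n @[n --> \oo] --> 0 ->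
    (forall n, {homo fn n : x y / x <= y}) ->
    (forall n x, 0 <= fn n x <= f x) ->
    (forall e, 0 < e -> \forall n \near \oo, forall x, f (x - e) <= fn n x) ->
    \forall n \near \oo,
      ((reach_estimator d l K r (U n) (fn n))%:E <= reach_at_most d f)%E.
Proof.
move=> K2 r0 r_incr ndf f0 fc.
have bf a b : bounded_measurable a b f := bounded_measurable_nondecreasing a b ndf.
have [/existsP[i0 i0P]|/existsPn noj] := boolP [exists i : 'I_K,
    (0 < i)%N && (reach_at_most d f < (r i)%:E)%E]; last first.
  exists d => // U fn _ _ _ _; near=> n.
  have K1 : (K.-1 < K)%N by case: K K2 {noj r_incr} => [|[]].
  have K0 : (0 < K.-1)%N by case: K K2 {noj r_incr K1} => [|[]].
  have := noj (Ordinal K1); rewrite /= K0 -leNgt.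
  by apply: le_trans; rewrite lee_fin reach_estimator_le_last.
have /ex_minnP[j] : exists j,
    [&& (0 < j)%N, (j < K)%N & (reach_at_most d f < (r j)%:E)%E].
  by exists i0; move/andP: i0P => [-> ->]; rewrite ltn_ord.
move=> /and3P[j0 jK fj] jmin {i0 i0P}.
set rho := residual 0 (r j) d f.
have rho0 : 0 < rho by exact: residual_gt0_reach.
(* With squared errors below [rho ^+ 2 / 16], the level [rho ^+ 2 / 4] separates the squared
   numerator of $c_j$ from the squared denominator. *)
have rho2 : 0 < rho ^+ 2 / 16 by rewrite divr_gt0 ?exprn_gt0.
have rj0 : 0 < r j by rewrite -r0; exact: (grid_lt r_incr j0 (ltnW jK)).
(* By [residual_perturb], the squared residual of [g] is above $\rho^2/2-\rho^2/16=7\rho^2/16$. *)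
have num g : bounded_measurable 0 (r j) g ->
    \int[mu]_(x in `[0, r j]) ((f x - g x) ^+ 2) < rho ^+ 2 / 16 ->
    rho ^+ 2 / 4 < residual 0 (r j) d g ^+ 2.
  by move=> bg; have := residual_perturb d rj0 (bf _ _) bg; rewrite -/rho; lra.
have [j1|j1] := eqVneq j 1%N.
  exists d => // U fn U0 ndfn fnf ffn; subst j.
  have /cvgr0Pnorm_lt/(_ _ rho2) L2 :=
    cvg_L2_squeeze 0 (r 1%N) ndf f0 ndfn fnf ffn.
  have rho_half : 0 < rho / 2 by rewrite divr_gt0.
  have /cvgr0Pnorm_lt/(_ _ rho_half) {}U0 := U0.
  apply: filterS2 U0 L2 => n /= Un Ln.
  rewrite reach_estimator_stop0; first exact: reach_ge0.
  apply: (@lt_trans _ _ (rho / 2)); first exact: le_lt_trans (ler_norm _) Un.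
  rewrite -(@ltr_pXn2r _ 2) ?nnegrE ?residual_ge0 ?(ltW rho_half) //.
  rewrite expr_div_n (_ : 2 ^+ 2 = 4); last by ring.
  apply: num; first exact: bounded_measurable_nondecreasing.
  exact: le_lt_trans (ler_norm _) Ln.
have j2 : (2 <= j)%N by case: j j0 j1 {fj jK jmin rho rho0 rho2 rj0 num} => [|[]].
have rjK : r j < r K by exact: (grid_lt r_incr jK (leqnn K)).
have [q qP] := nondecreasing_L2_approx rjK ndf rho2.
exists (maxn d (size q)); first exact: leq_maxl.
move=> U fn U0 ndfn fnf ffn.
have bfn a b n : bounded_measurable a b (fn n) :=
  bounded_measurable_nondecreasing a b (ndfn n).
have /cvgr0Pnorm_lt/(_ _ rho2) L2I := cvg_L2_squeeze 0 (r j) ndf f0 ndfn fnf ffn.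
have /cvgr0Pnorm_lt/(_ _ rho2) L2J :=
  cvg_L2_squeeze (r j) (r K) ndf f0 ndfn fnf ffn.
have j1_gt0 : (0 < j.-1)%N by rewrite -ltnS prednK.
(* Minimality of [j] is used here, with [j.-1] still a positive index. *)
have rj1 : ((r j.-1)%:E <= reach_at_most d f)%E.
  rewrite leNgt; apply/negP => fj1.
  have := jmin j.-1; rewrite fj1 (leq_ltn_trans (leq_pred _) jK) j1_gt0.
  by move=> /(_ isT); rewrite leqNgt prednK// leqnn.
apply: filterS2 L2I L2J => n /= LI LJ; apply: le_trans rj1; rewrite lee_fin.
apply: reach_estimator_le_ratio K2 r0 r_incr _ _ _; first by rewrite j2.
rewrite /ratio_gt1 -(@ltr_pXn2r _ 2) ?nnegrE ?residual_ge0 //.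
apply: (@lt_trans _ _ (rho ^+ 2 / 4)); last first.
  by apply: num; [exact: bfn|exact: le_lt_trans (ler_norm _) LI].
(* With [q] as competitor, the squared denominator is below $2\rho^2/16+2\rho^2/16=\rho^2/4$. *)
have qs : (size q <= (maxn d (size q)).+1)%N by rewrite ltnW// ltnS leq_maxr.
apply: (le_lt_trans (residual_sqr_le rjK (bfn _ _ _) qs)).
have := Rintegral_sqrB_le (bfn _ _ n) (bf (r j) (r K)) (bounded_measurable_horner _ _ q).
have : \int[mu]_(x in `[r j, r K]) ((fn n x - f x) ^+ 2) < rho ^+ 2 / 16.
  under eq_Rintegral do rewrite -sqrrN opprB.
  exact: le_lt_trans (ler_norm _) LJ.
move: qP; lra.
Unshelve. all: by end_near. Qed.

End ReachEstimator.

(** * Volume functions *)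

Section EuclideanNorm.
Context {R : realType} {d : nat}.
Implicit Types (x y z : 'rV[R]_d) (e : R).

Lemma sum_sqr_ge0 x : 0 <= \sum_(j < d) x 0 j ^+ 2.
Proof. by apply: sumr_ge0 => j _; exact: sqr_ge0. Qed.

Lemma enorm_ge0 x : 0 <= enorm x.
Proof. exact: sqrtr_ge0. Qed.

Lemma enorm_sqr x : enorm x ^+ 2 = \sum_(j < d) x 0 j ^+ 2.
Proof. exact: sqr_sqrtr (sum_sqr_ge0 x). Qed.

Lemma enormN x : enorm (- x) = enorm x.
Proof.
by rewrite /enorm; congr Num.sqrt; apply: eq_bigr => j _; rewrite mxE sqrrN.
Qed.

Lemma enormB x y : enorm (x - y) = enorm (y - x).
Proof. by rewrite -enormN opprB. Qed.

(** Cauchy-Schwarz, from the nonnegativity of the squared norm of $\|y\|^2x-\langle x,y\rangle y$.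
    The case $\|y\|=0$ is separate because $\|y\|^2$ is cancelled. *)
Lemma sum_mul_le_enorm x y : \sum_(j < d) x 0 j * y 0 j <= enorm x * enorm y.
Proof.
set C := \sum_(j < d) _.
have key : 0 <= enorm y ^+ 2 * (enorm x ^+ 2 * enorm y ^+ 2 - C ^+ 2).
  have -> : enorm y ^+ 2 * (enorm x ^+ 2 * enorm y ^+ 2 - C ^+ 2) =
      \sum_(j < d) (enorm y ^+ 2 * x 0 j - C * y 0 j) ^+ 2.
    transitivity (\sum_(j < d) (enorm y ^+ 2 ^+ 2 * x 0 j ^+ 2 +
        (- (2 * enorm y ^+ 2 * C)) * (x 0 j * y 0 j) + C ^+ 2 * y 0 j ^+ 2)).
      rewrite !big_split/= -!mulr_sumr -!enorm_sqr -/C; ring.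
    by apply: eq_bigr => j _; ring.
  by apply: sumr_ge0 => j _; exact: sqr_ge0.
have [y0|y0] := eqVneq (enorm y) 0.
  rewrite y0 mulr0 /C big1// => j _.
  have /eqP := enorm_sqr y; rewrite y0 expr0n/= eq_sym psumr_eq0; last first.
    by move=> i _; exact: sqr_ge0.
  by move=> /allP/(_ j (mem_index_enum j)); rewrite sqrf_eq0 => /eqP ->; rewrite mulr0.
have ypos : 0 < enorm y ^+ 2 by rewrite exprn_gt0// lt_neqAle eq_sym y0 enorm_ge0.
move: key; rewrite pmulr_rge0// subr_ge0 -exprMn => key.
apply: le_trans (ler_norm _) _.
rewrite -(@ler_pXn2r _ 2) ?nnegrE ?mulr_ge0 ?enorm_ge0//.
by rewrite real_normK ?num_real.
Qed.

Lemma ler_enormD x y : enorm (x + y) <= enorm x + enorm y.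
Proof.
rewrite -(@ler_pXn2r _ 2) ?nnegrE ?addr_ge0 ?enorm_ge0//.
rewrite enorm_sqr sqrrD !enorm_sqr.
have -> : \sum_(j < d) (x + y) 0 j ^+ 2 = \sum_(j < d) x 0 j ^+ 2 +
    2 * (\sum_(j < d) x 0 j * y 0 j) + \sum_(j < d) y 0 j ^+ 2.
  by rewrite mulr_sumr -!big_split/=; apply: eq_bigr => j _; rewrite mxE; ring.
by have := sum_mul_le_enorm x y; lra.
Qed.

Lemma ler_enorm_dist x y z : enorm (x - z) <= enorm (x - y) + enorm (y - z).
Proof. by apply: le_trans (ler_enormD _ _); rewrite addrA subrK. Qed.

Lemma coord_le_enorm x j : `|x 0 j| <= enorm x.
Proof.
rewrite -(@ler_pXn2r _ 2) ?nnegrE ?enorm_ge0// enorm_sqr real_normK ?num_real//.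
rewrite (bigD1 j)//= lerDl; apply: sumr_ge0 => i _; exact: sqr_ge0.
Qed.

Lemma enorm_le_coord x e : 0 <= e -> (forall j, `|x 0 j| <= e) ->
  enorm x <= d%:R * e.
Proof.
move=> e0 xe; rewrite -(@ler_pXn2r _ 2) ?nnegrE ?enorm_ge0 ?mulr_ge0//.
rewrite enorm_sqr; apply: (@le_trans _ _ (d%:R * e ^+ 2)).
  have -> : d%:R * e ^+ 2 = \sum_(j < d) e ^+ 2.
    by rewrite sumr_const card_ord mulr_natl.
  apply: ler_sum => j _.
  by rewrite -[leLHS]real_normK ?num_real// ler_sqr ?nnegrE.
rewrite exprMn; apply: ler_wpM2r; first exact: sqr_ge0.
case: d => [|n]; first by rewrite expr0n.
by rewrite expr2 ler_peMr// ler1n.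
Qed.

Lemma coord_le_norm x j : `|x 0 j| <= `|x|.
Proof.
rewrite [leRHS]/Num.Def.normr/= mx_normrE; apply/bigmax_geP; right => /=.
by exists (0, j).
Qed.

Lemma enorm_le_norm x : enorm x <= d%:R * `|x|.
Proof. by apply: enorm_le_coord => // j; exact: coord_le_norm. Qed.

Lemma cball_closed x e : closed (cball x e).
Proof.
rewrite (_ : cball x e = (fun y => enorm (y - x)) @^-1` [set r | r <= e])//.
apply: preimage_closed; last exact: closed_le.
move=> y _; apply/(@cvgrPdist_le _ _ _ (nbhs y)) => /= eps eps0.
(* Neighbourhoods are taken in the maximum norm, for which [enorm] is [d]-Lipschitz; [d.+1] keeps
   the radius positive for [d = 0]. *)
have dpos : 0 < eps / d.+1%:R by rewrite divr_gt0.
apply/nbhs_ballP; exists (eps / d.+1%:R) => //= z; rewrite -ball_normE/= => yz.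
have yzeps : enorm (y - z) <= eps.
  apply: le_trans (enorm_le_norm _) _.
  apply: (@le_trans _ _ (d.+1%:R * (eps / d.+1%:R))).
    by apply: ler_pM => //; [rewrite ler_nat|exact: ltW].
  by rewrite mulrCA divff ?mulr1// pnatr_eq0.
apply: le_trans yzeps.
have h1 := ler_enorm_dist y z x; have := ler_enorm_dist z y x.
rewrite (enormB z y) => h2.
by rewrite ler_norml; apply/andP; split; lra.
Qed.

Lemma compact_net (S : set 'rV[R]_d) e : compact S -> 0 < e ->
  exists s : seq 'rV[R]_d, (forall x, x \in s -> S x) /\
    forall y, S y -> exists2 x, x \in s & enorm (y - x) <= e.
Proof.
rewrite compact_cover => Sc e0; have dpos : 0 < e / d.+1%:R by rewrite divr_gt0.
have [] := Sc _ S (fun x => ball x (e / d.+1%:R)).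
- by move=> x _; exact: ball_open.
- by move=> x Sx; exists x => //; exact: ballxx.
move=> D DS SD; exists (enum_fset D); split=> [x xD|y /SD[x /= xD xy]].
  by have := DS _ xD; rewrite inE.
exists x => //; rewrite enormB; apply: le_trans (enorm_le_norm _) _.
apply: (@le_trans _ _ (d.+1%:R * (e / d.+1%:R))).
  by apply: ler_pM => //; [rewrite ler_nat|move: xy; rewrite -ball_normE/= => /ltW].
by rewrite mulrCA divff ?mulr1// pnatr_eq0.
Qed.

End EuclideanNorm.

(** * Thickenings and their Lebesgue measure *)

Section Volume.
Context {R : realType} {d : nat}.
Hypothesis d_gt0 : (0 < d)%N.
Implicit Types (x y a b : 'rV[R]_d) (A B S : set 'rV[R]_d) (e r s M : R).

(** The slack [e] is there because the infimum need not be attained. *)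
Lemma thickening_ex A r e y : 0 < e -> thickening A r y ->
  exists2 x, A x & enorm (y - x) < r + e.
Proof.
move=> e0 yA; apply: contrapT => nA.
have : ((r + e)%:E <= ereal_inf [set (enorm (y - x))%:E | x in A])%E.
  apply: le_ereal_inf_tmp => _ [x Ax <-]; rewrite lee_fin leNgt.
  by apply/negP => xr; apply: nA; exists x.
by move=> /le_trans/(_ yA); rewrite lee_fin gerDl leNgt e0.
Qed.

Lemma enorm_le_thickening A r x y : A x -> enorm (y - x) <= r ->
  thickening A r y.
Proof.
move=> Ax yx; apply: (@le_trans _ _ (enorm (y - x))%:E); last by rewrite lee_fin.
by apply: ereal_inf_lbound; exists x.
Qed.

Lemma thickeningS A B r s : A `<=` B -> r <= s ->
  thickening A r `<=` thickening B s.
Proof.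
move=> AB rs y /= yA; apply: (@le_trans _ _ r%:E); last by rewrite lee_fin.
by apply: le_trans yA; apply: ereal_inf_le_tmp; exact: image_subset.
Qed.

(** One half of [e] pays for the infimum in the thickening of [S], the other for the distance from
    [S] to [A]. For [s < e] the left-hand side is empty. *)
Lemma thickening_near A S e s : 0 < e ->
  (forall x, S x -> exists2 y, A y & enorm (x - y) <= e / 2) ->
  thickening S (s - e) `<=` thickening A s.
Proof.
move=> e0 SA y yS; have e20 : 0 < e / 2 by rewrite divr_gt0.
have [x Sx yx] := thickening_ex e20 yS; have [z Az xz] := SA _ Sx.
apply: (enorm_le_thickening Az); apply: le_trans (ler_enorm_dist _ x _) _.
lra.
Qed.

Lemma box_vol_eq0 a : box_vol a a = 0%E.
Proof.
rewrite /box_vol; congr EFin => /=.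
by rewrite (bigD1 (Ordinal d_gt0)) //= subrr maxxx mul0r.
Qed.

Lemma lebesgue_rV_box_lty a b : (lebesgue_rV (box a b) < +oo)%E.
Proof.
(* The box covers itself; the sequence is completed by degenerate boxes of volume zero. *)
pose c k := if k is 0%N then (a, b) else (a, a).
apply: (@le_lt_trans _ _ (\sum_(k <oo) box_vol (c k).1 (c k).2)%E).
  by apply: ereal_inf_lbound; exists c => // x xab; exists 0%N.
rewrite nneseries_recl//; last by move=> k _; exact: box_vol_ge0.
rewrite eseries0; first by rewrite adde0 ltry.
by case=> // k _ _; exact: box_vol_eq0.
Qed.

Definition coord_bounded A M := forall x, A x -> forall j, `|x 0 j| <= M.

Lemma compact_coord_bounded S : compact S -> exists M, coord_bounded S M.
Proof.
move=> /compact_bounded[M [_ SM]]; exists (M + 1) => x Sx j.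
by apply: le_trans (coord_le_norm _ _) _; apply: SM => //; rewrite ltrDl.
Qed.

Lemma lebesgue_rV_thickening_lty A M r : coord_bounded A M ->
  (lebesgue_rV (thickening A r) < +oo)%E.
Proof.
move=> AM; pose b : 'rV[R]_d := \row_j (r + 1 + M + 1).
apply: le_lt_trans (lebesgue_rV_box_lty (- b) b).
apply: le_lebesgue_rV => y /(@thickening_ex _ _ 1)[//|x Ax yx] j.
rewrite !mxE -ltr_norml.
have -> : y 0 j = (y - x) 0 j + x 0 j by rewrite !mxE subrK.
have := ler_normD ((y - x) 0 j) (x 0 j).
have := coord_le_enorm (y - x) j; have := AM _ Ax j; lra.
Qed.

Lemma volume_ge0 A r : 0 <= volume A r.
Proof. by apply: fine_ge0; exact: lebesgue_rV_ge0. Qed.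

(** The bounds provide finiteness: [fine] sends [+oo] to [0] and is monotone only on finite
    values. *)
Lemma le_volume A B M r s : coord_bounded A M -> coord_bounded B M ->
  thickening A r `<=` thickening B s -> volume A r <= volume B s.
Proof.
move=> AM BM AB; apply: fine_le; last exact: le_lebesgue_rV.
- by rewrite ge0_fin_numE ?lebesgue_rV_ge0// (lebesgue_rV_thickening_lty _ AM).
- by rewrite ge0_fin_numE ?lebesgue_rV_ge0// (lebesgue_rV_thickening_lty _ BM).
Qed.

Lemma volume_nondecreasing A M : coord_bounded A M ->
  {homo volume A : r s / r <= s}.
Proof. by move=> AM r s rs; apply: (le_volume AM AM); exact: thickeningS. Qed.

(** Translating a cover of one ball covers the other with boxes of the same volumes. *)
Lemma le_lebesgue_rV_cball x y e :
  (lebesgue_rV (cball y e) <= lebesgue_rV (cball x e))%E.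
Proof.
apply: le_ereal_inf_tmp => _ [c xc <-]; apply: ereal_inf_lbound.
exists (fun k => ((c k).1 + (y - x), (c k).2 + (y - x))); last first.
  apply: eq_eseriesr => k _; congr EFin; apply: eq_bigr => j _ /=.
  by rewrite !mxE opprD addrACA subrr addr0.
move=> z yz; have /xc[k _ ck] : cball x e (z - (y - x)).
  by move: yz; rewrite /cball/= opprB addrA addrAC addrK.
exists k => // j; have := ck j; rewrite !mxE => /andP[? ?].
by apply/andP; split; lra.
Qed.

(** If one ball of radius [e] were null, all would be by translation. Finitely many of them cover
    [thickening S 0], which would be null, against $V(0)>0$. *)
Lemma lebesgue_rV_cball_gt0 S x e : compact S -> 0 < volume S 0 -> 0 < e ->
  (0 < lebesgue_rV (cball x e))%E.
Proof.
move=> Sc V0 e0; rewrite lt_neqAle lebesgue_rV_ge0 andbT; apply/eqP => xe.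
have ball0 y : lebesgue_rV (cball y e) = 0%E.
  by apply/eqP; rewrite eq_le lebesgue_rV_ge0 andbT [leRHS]xe le_lebesgue_rV_cball.
have e20 : 0 < e / 2 by rewrite divr_gt0.
have [s [_ sS]] := compact_net Sc e20.
suff S0 : lebesgue_rV (thickening S 0) = 0%E.
  by move: V0; rewrite /volume S0 ltxx.
apply/eqP; rewrite eq_le lebesgue_rV_ge0 andbT.
(* Past the end of [s], [nth] returns the origin, whose ball is null as well. *)
apply: (@le_trans _ _ (lebesgue_rV (\bigcup_n cball (nth 0 s n) e))).
  apply: le_lebesgue_rV => y /(thickening_ex e20)[z Sz yz].
  have [w ws zw] := sS _ Sz; exists (index w s) => //.
  rewrite nth_index// /cball/=; apply: le_trans (ler_enorm_dist _ z _) _.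
  by move: yz; lra.
apply: (le_trans (lebesgue_rV_sigma_subadditive _)).
by rewrite eseries0// => k _ _; exact: ball0.
Qed.

End Volume.

(** * Random samples *)

Section Sampling.
Context {R : realType} {d : nat}.
Implicit Types (S B : set 'rV[R]_d) (x y : 'rV[R]_d) (e : R).

Lemma closed_borel_measurable B :
  closed B -> measurable (B : set (borel_rV R d)).
Proof.
move=> cB; rewrite -[B]setCK; apply: (@measurableC _ (borel_rV R d)).
by apply: sub_sigma_algebra; rewrite openC.
Qed.

Lemma standard_cball_gt0 S (nu : {measure set (borel_rV R d) -> \bar R}) x e :
  compact S -> 0 < volume S 0 -> standard S nu -> S x -> 0 < e ->
  (0 < nu (cball x e `&` S))%E.
Proof.
move=> Sc V0 [lambda [delta [l0 de0 std]]] Sx e0.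
have cS : closed S by apply: compact_closed Sc; exact: norm_hausdorff.
(* Standardness bounds only the balls of radius at most [lambda]; a larger ball contains such a
   ball. *)
have me0 : 0 < Num.min e lambda by rewrite lt_min e0.
apply: (@lt_le_trans _ _ (nu (cball x (Num.min e lambda) `&` S))).
  apply: lt_le_trans (std _ _ Sx _); last by rewrite me0 ge_min lexx orbT.
  by rewrite mule_gt0// (lebesgue_rV_cball_gt0 _ Sc).
apply: le_measure; rewrite ?inE.
- by apply: closed_borel_measurable; apply: closedI cS; exact: cball_closed.
- by apply: closed_borel_measurable; apply: closedI cS; exact: cball_closed.
- by apply: setSI => y /le_trans; apply; rewrite ge_min lexx.
Qed.

Section RandomSample.
Context {disp : measure_display} {Omega : measurableType disp}.
Context {P : probability Omega R} (X : nat -> {RV P >-> borel_rV R d}).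
Context (PX : probability (borel_rV R d) R).
Hypotheses (X_indep : mutually_independent X)
  (X_distr : identically_distributed X PX).

(** By independence the first [n] points all miss [B] with probability [q ^+ n], where [q < 1] is
    the mass of the complement. *)
Lemma ae_hit (B : set (borel_rV R d)) : measurable B -> (0 < PX B)%E ->
  {ae P, forall w, exists i, B (X i w)}.
Proof.
move=> mB B0; have mBC : measurable (~` B) by exact: measurableC.
pose q := fine (PX (~` B)).
have qE : PX (~` B) = q%:E.
  by rewrite fineK// ge0_fin_numE// (le_lt_trans (probability_le1 PX mBC)) ?ltry.
have q0 : 0 <= q by exact: fine_ge0.
have q1 : q < 1.
  rewrite -lte_fin -qE probability_setC// lteBlDr; last first.
    by rewrite ge0_fin_numE// (le_lt_trans (probability_le1 PX mB)) ?ltry.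
  by rewrite -[ltLHS]adde0 lteD2lE.
pose N := \bigcap_i (X i @^-1` (~` B)).
have mX i : measurable (X i @^-1` (~` B)).
  by rewrite -[X in measurable X]setTI; exact: measurable_funPT.
have mN : measurable N by apply: bigcapT_measurable.
have PN n : (P N <= (q ^+ n)%:E)%E.
  pose J := [fset i in iota 0 n]%fset.
  have -> : (q ^+ n)%:E = (\prod_(i <- J) P (X i @^-1` (~` B)))%E.
    rewrite (eq_bigr (fun=> q%:E)); last first.
      by move=> i _; rewrite -qE -(X_distr i).
    rewrite prodEFin big_const_seq count_predT iter_mulr_1; congr (_ ^+ _)%:E.
    by rewrite -[size _]/(#|` J|) card_fseq undup_id ?iota_uniq// size_iota.
  rewrite -X_indep//; apply: le_measure; rewrite ?inE//.
  - by apply: fin_bigcap_measurable.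
  - by move=> w Nw i _; exact: Nw.
exists N; split=> //; last first.
  by move=> w /= /forallNP nB i _; exact: nB.
apply/eqP; rewrite eq_le measure_ge0 andbT; apply/lee_addgt0Pr => e e0.
have : q ^+ n @[n --> \oo] --> 0 by apply: cvg_expr; rewrite ger0_norm.
move=> /cvgr0Pnorm_lt/(_ _ e0)/filter_ex[n /= qn].
rewrite add0e; apply: le_trans (PN n) _; rewrite lee_fin.
exact: ltW (le_lt_trans (ler_norm _) qn).
Qed.

(** To have one almost sure event for all [e], only countably many balls are considered: those of
    radius $1/(k+1)$ about the points of a finite net of that mesh. *)
Lemma ae_sample_dense S : compact S -> 0 < volume S 0 -> standard S PX ->
  {ae P, forall w, forall e, 0 < e -> \forall n \near \oo,
    forall x, S x -> exists2 y, sample X n w y & enorm (x - y) <= e}.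
Proof.
move=> Sc V0 std.
have inv0 k : 0 < k.+1%:R^-1 :> R by rewrite invr_gt0 ltr0n.
have cS : closed S by apply: compact_closed Sc; exact: norm_hausdorff.
have /choice[s sP] := fun k => compact_net Sc (inv0 k).
have hit : {ae P, forall w, forall k m, (m < size (s k))%N ->
    exists i, (cball (nth 0 (s k) m) k.+1%:R^-1 `&` S) (X i w)}.
  apply: ae_foralln => k; apply: ae_foralln => m.
  have [ms|ms] := ltnP m (size (s k)); last exact/aeW.
  have := @ae_hit (cball (nth 0 (s k) m) k.+1%:R^-1 `&` S).
  have mC : measurable (cball (nth 0 (s k) m) k.+1%:R^-1 `&` S : set (borel_rV R d)).
    by apply: closed_borel_measurable; apply: closedI cS; exact: cball_closed.
  move=> /(_ mC); have Sm : S (nth 0 (s k) m) by apply: (sP k).1; exact: mem_nth.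
  move=> /(_ (standard_cball_gt0 Sc V0 std Sm (inv0 k))).
  by apply: filterS => w ? _.
apply: filterS hit => w hit e e0.
pose k := Num.bound (e / 2)^-1.
have ke : k.+1%:R^-1 <= e / 2.
  rewrite -[leRHS]invrK lef_pV2 ?posrE ?invr_gt0 ?divr_gt0//.
  apply/ltW/(lt_le_trans (archi_boundP _)); last by rewrite ler_nat.
  by rewrite invr_ge0 ltW// divr_gt0.
(* [u m] is the number of a sample point in the ball about the net point of index [m]. The sample of
   size [n] holds the numbers below [n], so any [n] above the maximum of [u] will do. *)
have /choice[u uP] : forall m, exists i, (m < size (s k))%N ->
    cball (nth 0 (s k) m) k.+1%:R^-1 (X i w).
  move=> m; have [ms|ms] := ltnP m (size (s k)); last by exists 0%N.
  by have [i [Xi _]] := hit k m ms; exists i.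
exists (\max_(m < size (s k)) u m).+1 => // n /= nu x Sx.
have [y ys xy] := (sP k).2 _ Sx.
have ms : (index y (s k) < size (s k))%N by rewrite index_mem.
exists (X (u (index y (s k))) w).
  exists (u (index y (s k))) => //=; apply: leq_trans nu; rewrite ltnS.
  exact: (leq_bigmax (Ordinal ms)).
apply: le_trans (ler_enorm_dist _ y _) _.
have := uP _ ms; rewrite nth_index// /cball/= => yu.
rewrite (enormB y) [leRHS]splitr.
by apply: lerD; [exact: le_trans xy ke|exact: le_trans yu ke].
Qed.

End RandomSample.

End Sampling.

(** * Two limits, and the conclusion *)

(** Since $\log n=2\log\sqrt n<2\sqrt n$, the quotient is below $2/\sqrt n$. *)
Lemma ln_div_cvg0 {R : realType} : (ln n%:R / n%:R : R) @[n --> \oo] --> 0.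
Proof.
apply/cvgr0Pnorm_lt => e e0; near=> n.
have n1 : (1 <= n)%N by near: n; exists 1%N.
have n0 : 0 < n%:R :> R by rewrite ltr0n.
have sn0 : 0 < Num.sqrt n%:R :> R by rewrite sqrtr_gt0.
have nE : n%:R = Num.sqrt n%:R ^+ 2 :> R by rewrite sqr_sqrtr// ltW.
rewrite ger0_norm; last by rewrite divr_ge0 ?ln_ge0 ?ler1n// ltW.
rewrite ltr_pdivrMr// [in ltLHS]nE lnXn// [in ltRHS]nE -[ln _ *+ 2]mulr_natl.
apply: (@lt_le_trans _ _ (2 * Num.sqrt n%:R)).
  by rewrite ltr_pM2l// ln_sublinear.
rewrite expr2 mulrA; apply: ler_wpM2r; first exact: ltW.
rewrite -ler_pdivrMl// -(@ler_pXn2r _ 2) ?nnegrE ?sqrtr_ge0 ?mulr_ge0 ?invr_ge0 ?ltW//.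
rewrite -nE; near: n; exists (Num.bound ((e^-1 * 2) ^+ 2)) => // n /= Cn.
apply: (lt_le_trans (archi_boundP _)); last by rewrite ler_nat.
exact: sqr_ge0.
Unshelve. all: by end_near. Qed.

Lemma threshold_cvg0 {R : realType} (d : nat) (eta : R) :
  eta < (2 * d%:R)^-1 -> threshold d eta n @[n --> \oo] --> 0.
Proof.
move=> etad; have p0 : 0 < (2 * d%:R)^-1 - eta by rewrite subr_gt0.
rewrite /threshold; move: (_ - eta) p0 => p p0.
apply/cvgr0Pnorm_lt => e e0.
have ep0 : 0 < e `^ p^-1 by rewrite powR_gt0.
have /cvgr0Pnorm_lt/(_ _ ep0) := @ln_div_cvg0 R.
apply: filterS2 (nbhs_infty_ge 1) => n /= n1 un.
rewrite ger0_norm ?powR_ge0//.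
have -> : e = (e `^ p^-1) `^ p by rewrite -powRrM mulVf ?powRr1 ?ltW// gt_eqF.
rewrite gt0_ltr_powR ?nnegrE//.
- by rewrite divr_ge0 ?ln_ge0 ?ler1n.
- exact: ltW.
- exact: le_lt_trans (ler_norm _) un.
Qed.

(** For [h > 0], [f h] is [f 0] plus [h] times a difference quotient with a finite limit. *)
Lemma right_derivable_cvg {R : realType} (f : R -> R) :
  finite_right_derivative0 f -> f x @[x --> 0^'+] --> f 0.
Proof.
move=> /cvg_ex[l fl].
have x0 : x @[x --> (0 : R)^'+] --> (0 : R) by apply: cvg_at_right_filter; exact: cvg_id.
apply: (@cvg_trans _ ((f 0 + h * ((f h - f 0) / h)) @[h --> (0 : R)^'+])).
  apply: near_eq_cvg; near=> h.
  have h0 : h != 0 by rewrite gt_eqF//; near: h; exact: nbhs_right_gt.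
  by rewrite mulrCA divff// mulr1 addrC subrK.
have : f 0 + h * ((f h - f 0) / h) @[h --> (0 : R)^'+] --> f 0 + 0 * l.
  by apply: cvgD; [exact: cvg_cst|exact: cvgM].
by rewrite mul0r addr0.
Unshelve. all: by end_near. Qed.

Theorem theorem3 (R : realType) (d : nat) (d_gt0 : (0 < d)%N)
    (S : set 'rV[R]_d) (S_neq0 : S !=set0) (S_compact : compact S)
    (V0_gt0 : 0 < volume S 0)
    (V_derivable0 : finite_right_derivative0 (volume S))
    (L0_finite : finite_minkowski_content S)
    (disp : measure_display) (Omega : measurableType disp)
    (P : probability Omega R) (X : nat -> {RV P >-> borel_rV R d})
    (PX : probability (borel_rV R d) R)
    (X_in_S : forall i, {ae P, forall w, S (X i w)})
    (X_indep : mutually_independent X)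
    (X_distr : identically_distributed X PX)
    (S_standard : standard S PX)
    (K : nat) (K_ge2 : (2 <= K)%N) (r : nat -> R) (r0 : r 0%N = 0)
    (r_incr : forall i, (i < K)%N -> r i < r i.+1)
    (eta : R) (eta_gt0 : 0 < eta) (eta_lt : eta < (2 * d%:R)^-1) :
  exists2 l : nat, (d <= l)%N &
    {ae P, forall w, \forall n \near \oo,
      ((reach_estimator d l K r (threshold d eta n)
          (volume (sample X n w)))%:E <= polynomial_reach S)%E}.
Proof.
have [M SM] := compact_coord_bounded S_compact.
have ndV := volume_nondecreasing d_gt0 SM.
have [l dl lP] := reach_estimator_le_reach d K_ge2 r0 r_incr ndV
  (volume_ge0 S) (right_derivable_cvg V_derivable0).
exists l => //.
have aeS : {ae P, forall w, forall i, S (X i w)} by exact: ae_foralln.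
have aeD := ae_sample_dense X_indep X_distr S_compact V0_gt0 S_standard.
apply: filterS2 aeS aeD => w XS dense.
have subS n : sample X n w `<=` S by move=> _ [i _ <-].
have bX n : coord_bounded (sample X n w) M by move=> x /subS; exact: SM.
(* On this event the sample lies in [S], so $V_n\le V$, and it is eventually [e / 2]-dense in [S],
   so $V(x-e)\le V_n(x)$. *)
apply: lP; first exact: threshold_cvg0.
- by move=> n; exact: (volume_nondecreasing d_gt0 (bX n)).
- move=> n x; rewrite volume_ge0/=.
  exact: (le_volume d_gt0 (bX n) SM (thickeningS (@subS n) (lexx x))).
- move=> e e0; have e20 : 0 < e / 2 by rewrite divr_gt0.
  apply: filterS (dense _ e20) => n Xn x.
  exact: (le_volume d_gt0 SM (bX n) (thickening_near e0 Xn)).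
Qed.
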